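(* Let $f$ be an isomorphism-invariant monic graph polynomial of exponential type which is 2-multiplicative. For $k\ge1$ let $p_k(G)$ be the $k$-th power sum of the roots of $f(G,x)$ (with multiplicity). Then $p_k$ is a finite complex linear combination of the functions $H(\cdot)$ with $H$ ranging over 2-connected graphs satisfying $2\le|V(H)|\le k+1$.
   Context: All graphs are finite simple graphs; 2-connected graphs have at least two vertices. A graph polynomial assigns to each graph $G$ a polynomial $f(G,x)\in\mathbb{C}[x]$; monic means $f(G,x)$ is monic of degree $|V(G)|$; isomorphism-invariant means $G_1\cong G_2$ implies $f(G_1,x)=f(G_2,x)$; of exponential type means $f(\emptyset,x)=1$ and $\sum_{S\subseteq V(G)}f(G[S],x)f(G[V(G)\setminus S],y)=f(G,x+y)$ for all $G$; multiplicative means $f(G_1\uplus G_2,x)=f(G_1,x)f(G_2,x)$ for disjoint unions; 2-multiplicative means multiplicative and $x f(G_1\cup G_2,x)=f(G_1,x)f(G_2,x)$ whenever $G_1,G_2$ share exactly one vertex. $H(G)$ is the number of (not necessarily induced) subgraphs of $G$ isomorphic to $H$. *)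

(* Defs.v *)
From HB Require Import structures.
From mathcomp Require Import all_boot all_order all_algebra.
From mathcomp Require Import boolp reals.
From mathcomp Require Import complex.

Set Implicit Arguments.
Unset Strict Implicit.
Unset Printing Implicit Defensive.

Import GRing.Theory.
Local Open Scope ring_scope.

Record sgraph := SGraph {
  vertex :> finType;
  edges : {set {set vertex}};
  card_edges : forall e, e \in edges -> #|e| = 2%N
}.

Definition adj (G : sgraph) : rel G := fun x y => [set x; y] \in edges G.

Definition isomorphic (G1 G2 : sgraph) : Prop :=
  exists h : G1 -> G2,
    bijective h /\
    forall e : {set G1}, (h @: e \in edges G2) = (e \in edges G1).

Definition is_subgraph (G : sgraph) (W : {set G}) (F : {set {set G}}) : bool :=
  (F \subset edges G) && [forall e in F, e \subset W].

Section Subgraph.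
Variables (G : sgraph) (W : {set G}) (F : {set {set G}}).

Definition subgraph_edges : {set {set {x : G | x \in W}}} :=
  [set e : {set {x : G | x \in W}} | val @: e \in F :&: edges G].

Fact subgraph_card_edges e : e \in subgraph_edges -> #|e| = 2%N.
Proof.
rewrite !inE => /andP[_ /card_edges]; rewrite card_imset //; exact: val_inj.
Qed.

(* The graph with vertex set W and edge set F. It is total in F: members of F
   that are not edges of G, or not contained in W, are dropped, which does
   nothing when [is_subgraph W F] holds. *)
Definition subgraph : sgraph := SGraph subgraph_card_edges.

End Subgraph.

Definition induced (G : sgraph) (W : {set G}) : sgraph := subgraph W (edges G).

Definition subgraph_count (H G : sgraph) : nat :=
  #|[set S : {set G} * {set {set G}} |
      is_subgraph S.1 S.2 && `[< isomorphic H (subgraph S.1 S.2) >]]|.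

Definition connected (G : sgraph) : Prop :=
  (0 < #|G|)%N /\ forall x y : G, connect (@adj G) x y.

(* K_2 is 2-connected under this convention, K_1 is not. *)
Definition two_connected (G : sgraph) : Prop :=
  [/\ (2 <= #|G|)%N, connected G
    & forall v : G, connected (induced (~: [set v]))].

Section GraphPolynomial.
Variables (R : realType) (f : sgraph -> {poly R[i]}).

Definition iso_invariant : Prop :=
  forall G1 G2, isomorphic G1 G2 -> f G1 = f G2.

Definition monic_graph_poly : Prop :=
  forall G, f G \is monic /\ size (f G) = #|G|.+1.

Definition exponential_type : Prop :=
  (forall G : sgraph, #|G| = 0%N -> f G = 1) /\
  forall (G : sgraph) (x y : R[i]),
    \sum_(S : {set G}) (f (induced S)).[x] * (f (induced (~: S))).[y]
      = (f G).[x + y].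

(* The (W1, F1) and (W2, F2) below are subgraphs whose union is G; up to
   isomorphism, any two graphs with disjoint vertex sets, respectively with
   exactly one common vertex, arise in this way. *)
Definition is_union (G : sgraph) (W1 W2 : {set G}) (F1 F2 : {set {set G}}) :=
  [/\ is_subgraph W1 F1, is_subgraph W2 F2,
      W1 :|: W2 = [set: G] & F1 :|: F2 = edges G].

Definition multiplicative : Prop :=
  forall (G : sgraph) (W1 W2 : {set G}) (F1 F2 : {set {set G}}),
    is_union W1 W2 F1 F2 -> #|W1 :&: W2| = 0%N ->
    f G = f (subgraph W1 F1) * f (subgraph W2 F2).

Definition two_multiplicative : Prop :=
  multiplicative /\
  forall (G : sgraph) (W1 W2 : {set G}) (F1 F2 : {set {set G}}),
    is_union W1 W2 F1 F2 -> #|W1 :&: W2| = 1%N ->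
    'X * f G = f (subgraph W1 F1) * f (subgraph W2 F2).

End GraphPolynomial.

(* All roots of p, listed with multiplicity (for p != 0). *)
Definition roots_mult (R : realType) (p : {poly R[i]}) : seq R[i] :=
  sval (closed_field_poly_normal p).

Definition root_power_sum (R : realType) (k : nat) (p : {poly R[i]}) : R[i] :=
  \sum_(z <- roots_mult p) z ^+ k.

(* Main.v *)
Require Import Defs.
From mathcomp Require Import all_boot all_order all_algebra.
From mathcomp Require Import boolp reals.
From mathcomp Require Import complex ring zify.

(* Call a vertex or an edge of G a cell.  Moebius inversion over the Boolean
   lattice of sets of cells writes any isomorphism-invariant g as
   g(G) = sum over subgraphs H of G of m(H), where m is again
   isomorphism-invariant; so g is a combination of subgraph counts with
   coefficients m(H), and for g = p_k it remains to see where m vanishes.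

   - H not 2-connected: H is a union of two proper subgraphs sharing at most one
     vertex, 2-multiplicativity makes p_k of every subgraph of H the sum of its
     values on the two parts, and a function that ignores some cell has zero
     Moebius coefficient at the top.

   - H connected with more than k + 1 vertices: filter functions on sets of
     cells by the graphic rank of the support of their Moebius transform.  The
     rank is subadditive under unions, so the filtration is multiplicative.
     Differentiating the exponential identity in y at y = 0 gives
     f'(G) = sum_B f(G[B])_1 f(G - B), from which the coefficient e_j of
     x^(n - j) has rank at most j; Newton's identities then give p_k rank at
     most k, whereas a connected graph on n vertices has rank n - 1. *)

Set Implicit Arguments.
Unset Strict Implicit.
Unset Printing Implicit Defensive.

Import Order.TTheory GRing.Theory Num.Theory.
Local Open Scope ring_scope.


(** * Moebius inversion on a Boolean lattice *)

Section Mobius.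
Variables (K : comNzRingType) (X : finType).
Implicit Types (phi psi c : {set X} -> K) (S T U : {set X}) (x : X).

(** The coefficient at [S] when [phi] is expanded in the indicators [T |-> (U \subset T)];
    [mobius_inv] is that expansion. *)
Definition mobius phi S : K :=
  \sum_(T : {set X} | T \subset S) (-1) ^+ #|S :\: T| * phi T.

(** Pairing [T] with [x |: T] is a sign-reversing involution. *)
Lemma sum_toggle0 x (P : pred {set X}) (F : {set X} -> K) :
  (forall T, x \notin T -> P (x |: T) = P T) ->
  (forall T, x \notin T -> F (x |: T) = - F T) ->
  \sum_(T | P T) F T = 0.
Proof.
move=> Px Fx; rewrite (bigID (fun T => x \in T)) /=.
rewrite (reindex_onto (fun T => x |: T) (fun T => T :\ x)) /=; last first.
  by move=> T /andP[_ xT]; rewrite setD1K.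
have E T : (P (x |: T) && (x \in x |: T) && ((x |: T) :\ x == T))
    = (P T && (x \notin T)).
  case xT: (x \in T) => /=.
    by rewrite andbF; apply/negbTE/negP => /andP[_ /eqP eT];
       move: xT; rewrite -eT setD11.
  by rewrite Px ?xT // setU11 !andbT setU1K ?xT // eqxx andbT.
rewrite (eq_bigl _ _ E) -big_split /= big1 // => T /andP[_ xT].
by rewrite Fx // addNr.
Qed.

Lemma eq_mobius phi psi S :
  (forall T, T \subset S -> phi T = psi T) -> mobius phi S = mobius psi S.
Proof. by move=> e; apply: eq_bigr => T /e ->. Qed.

Lemma mobius_indep x phi S :
  x \in S -> (forall T, T \subset S -> x \notin T -> phi (x |: T) = phi T) ->
  mobius phi S = 0.
Proof.
move=> xS phix; rewrite /mobius.
(* The guard moves into the summand, since [phi] is known to ignore [x] only below [S], while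
   [sum_toggle0] quantifies over all sets. *)
have -> : \sum_(T : {set X} | T \subset S) (-1) ^+ #|S :\: T| * phi T =
  \sum_(T : {set X} | T \subset S)
    (-1) ^+ #|S :\: T| * (if T \subset S then phi T else 0).
  by apply: eq_bigr => T ->.
apply: (@sum_toggle0 x) => T xT; first by rewrite subUset sub1set xS.
rewrite subUset sub1set xS /=; case: ifP => TS; last by rewrite !mulr0 oppr0.
rewrite phix // (cardsD1 x (S :\: T)) !inE xT xS /= -mulNr exprS mulN1r opprK.
suff -> : S :\: (x |: T) = (S :\: T) :\ x by [].
by apply/setP => y; rewrite !inE negb_or andbA.
Qed.

(** Unless [U = S], the indicator is zero on all subsets of [S] or ignores a point of [S] outside
    [U]. *)
Lemma mobius_sub_ind U S :
  mobius (fun T => (U \subset T)%:R) S = (U == S)%:R.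
Proof.
case: (boolP (U == S)) => [/eqP->|neUS].
  rewrite /mobius (bigD1 S) //= subxx setDv cards0 expr0 mulr1 big1 ?addr0 //.
  move=> T /andP[TS neTS]; case: (boolP (S \subset T)) => ST; last by rewrite mulr0.
  by move: neTS; rewrite eqEsubset TS ST.
have [US|nUS] := boolP (U \subset S); last first.
  rewrite /mobius big1 // => T TS; case: (boolP (U \subset T)) => UT; last first.
    by rewrite mulr0.
  by move: nUS; rewrite (subset_trans UT TS).
have /properP[_ [x xS xU]] : U \proper S by rewrite properEneq neUS.
apply: (mobius_indep xS) => T _ xT; congr (_%:R).
case: (boolP (U \subset T)) => UT.
  by rewrite (subset_trans UT) ?subsetUr.
apply/eqP; rewrite eqb0; apply: contra UT => /subsetP UT; apply/subsetP => y yU.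
by have := UT y yU; rewrite !inE; case: eqP yU xU => // -> ->.
Qed.

Lemma mobius_sum (I : Type) (r : seq I) (P : pred I) (F : I -> {set X} -> K) S :
  mobius (fun T => \sum_(i <- r | P i) F i T) S
  = \sum_(i <- r | P i) mobius (F i) S.
Proof.
rewrite /mobius exchange_big /=; apply: eq_bigr => T _.
by rewrite mulr_sumr.
Qed.

Lemma mobiusZ a phi S : mobius (fun T => a * phi T) S = a * mobius phi S.
Proof. by rewrite /mobius mulr_sumr; apply: eq_bigr => T _; rewrite mulrCA. Qed.

Lemma mobiusD phi psi S :
  mobius (fun T => phi T + psi T) S = mobius phi S + mobius psi S.
Proof. by rewrite /mobius -big_split; apply: eq_bigr => T _; rewrite mulrDr. Qed.

(** Exhibiting an expansion in indicators determines the transform; restrictions and products are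
    computed this way. *)
Lemma mobius_unique c phi :
  (forall S, phi S = \sum_T c T * (T \subset S)%:R) -> mobius phi =1 c.
Proof.
move=> phiE S; rewrite (eq_mobius (psi := fun S => \sum_T c T * (T \subset S)%:R)).
  rewrite mobius_sum (bigD1 S) //= mobiusZ mobius_sub_ind eqxx mulr1 big1 ?addr0 //.
  by move=> T /negbTE neT; rewrite mobiusZ mobius_sub_ind neT mulr0.
by move=> T _; apply: phiE.
Qed.

(** After exchanging sums, [phi U] is multiplied by an alternating sum over the interval from [U] to
    [S], which cancels unless [U = S]. *)
Lemma mobius_inv phi S : phi S = \sum_T mobius phi T * (T \subset S)%:R.
Proof.
rewrite -[LHS]mulr1.
have -> : \sum_T mobius phi T * (T \subset S)%:R
  = \sum_U phi U * \sum_(T : {set X} | (U \subset T) && (T \subset S))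
      (-1) ^+ #|T :\: U|.
  under eq_bigr do rewrite /mobius mulr_suml.
  rewrite (exchange_big_dep predT) //=; apply: eq_bigr => U _.
  rewrite mulr_sumr [RHS]big_mkcondr /=; apply: eq_bigr => T UT.
  by case: ifP => _; rewrite ?mulr0 // mulr1 mulrC.
rewrite (bigD1 S) //= (big_pred1 S) => [|T]; last first.
  by rewrite /= eqEsubset andbC.
rewrite setDv cards0 expr0 big1 ?addr0 // => U neUS.
case: (boolP (U \subset S)) => US; last first.
  rewrite big_pred0 ?mulr0 // => T; apply/negbTE; apply: contra US => /andP[].
  exact: subset_trans.
have /properP[_ [x xS xU]] : U \proper S by rewrite properEneq neUS.
rewrite (@sum_toggle0 x) ?mulr0 // => T xT.
  rewrite subUset sub1set xS /=; congr (_ && _); apply/idP/idP => [/subsetP UT|UT].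
    apply/subsetP => y yU; have := UT y yU; rewrite !inE; case: eqP yU xU => // ->.
    by move=> ->.
  by rewrite (subset_trans UT) ?subsetUr.
rewrite (cardsD1 x) !inE eqxx xU /= exprS mulN1r.
suff -> : (x |: T) :\: U :\ x = T :\: U by [].
by apply/setP => y; rewrite !inE; case: eqP => //= ->; rewrite (negbTE xT) andbF.
Qed.

Lemma mobius_restrict phi U S :
  mobius (fun T => phi (T :&: U)) S = mobius phi S * (S \subset U)%:R.
Proof.
move: S; apply: mobius_unique => S; rewrite [LHS]mobius_inv; apply: eq_bigr => T _.
by rewrite subsetI -mulrA -natrM mulnb andbC.
Qed.

(** The product of the indicators of [V.1] and [V.2] is the indicator of their union. *)
Lemma mobiusM phi psi S :
  mobius (fun T => phi T * psi T) S
  = \sum_(V : {set X} * {set X} | V.1 :|: V.2 == S) mobius phi V.1 * mobius psi V.2.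
Proof.
move: S; apply: mobius_unique => S.
rewrite [in LHS]mobius_inv [X in _ * X]mobius_inv mulr_suml.
under eq_bigr do rewrite mulr_sumr.
rewrite pair_big /= (partition_big (fun V : {set X} * {set X} => V.1 :|: V.2) predT) //=.
apply: eq_bigr => T _; rewrite mulr_suml; apply: eq_bigr => V /eqP <-.
by rewrite subUset mulrACA -natrM mulnb.
Qed.

End Mobius.


Lemma mobius_imset (K : comNzRingType) (X Y : finType) (i : X -> Y)
    (phi : {set X} -> K) (psi : {set Y} -> K) (S : {set X}) :
  injective i -> (forall T : {set X}, T \subset S -> phi T = psi (i @: T)) ->
  mobius phi S = mobius psi (i @: S).
Proof.
move=> i_inj phiE; rewrite /mobius.
have preK (T : {set X}) : i @^-1: (i @: T) = T.
  by apply/setP => x; rewrite inE mem_imset.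
rewrite [RHS](reindex_onto (fun T : {set X} => i @: T) (fun U => i @^-1: U)) /=.
  apply: eq_big => [T|T TS].
    rewrite preK eqxx andbT; apply/idP/idP => [|iT]; first exact: imsetS.
    by rewrite -[T]preK -[S]preK preimsetS.
  rewrite phiE // !cardsD -imsetI ?card_imset //.
  by move=> x y _ _; apply: i_inj.
move=> U /subsetP US; apply/setP => y; apply/imsetP/idP => [[x + ->]|yU].
  by rewrite inE.
by have /imsetP[x xS yx] := US y yU; exists x; rewrite ?inE -?yx.
Qed.

(** * Newton's identities *)

(* The coefficient of X^(n - j) in a polynomial p of degree n, read as 0 when
   j > n. *)
Definition rcoef (K : nzRingType) (n j : nat) (p : {poly K}) : K :=
  if (j <= n)%N then p`_(n - j) else 0.

Section Newton.
Variable (K : comNzRingType).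
Implicit Type s : seq K.

Let a s j := rcoef (size s) j (\prod_(z <- s) ('X - z%:P)).

Lemma rcoef_consS z s j :
  rcoef (size (z :: s)) j.+1 (\prod_(y <- z :: s) ('X - y%:P))
  = a s j.+1 - z * a s j.
Proof.
rewrite /a /rcoef /= big_cons mulrBl coefB coefXM coefCM ltnS subSS.
have [ltj|gtj|->] := ltngtP j (size s).
- by rewrite subn_eq0 leqNgt ltj subnS.
- by rewrite mulr0 subrr.
- by rewrite subnn eqxx.
Qed.

Lemma rcoef_prod_XsubC0 s : a s 0 = 1.
Proof.
have := monic_prod_XsubC s xpredT (@id K).
by rewrite monicE lead_coefE size_prod_XsubC /a /rcoef leq0n subn0 => /eqP.
Qed.

Let pw s i := \sum_(z <- s) z ^+ i.

(** Induction on the roots: the identity for [z :: s] at [k.+1] is the one for [s] at [k.+1] minus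
    [z] times the one for [s] at [k]. The signs are absorbed in [a], and [k > size s] is covered
    because [a s k] is then 0. *)
Lemma newton_prod_XsubC s k : k%:R * a s k + \sum_(i < k) a s i * pw s (k - i) = 0.
Proof.
elim: s k => [|z s IHs] k.
  rewrite big1 ?addr0 => [|i _]; last by rewrite /pw big_nil mulr0.
  case: k => [|k]; first by rewrite mul0r.
  by rewrite /a /rcoef /= mulr0.
case: k => [|k]; first by rewrite mul0r add0r big_ord0.
have aS i : a (z :: s) i.+1 = a s i.+1 - z * a s i := rcoef_consS z s i.
have a0 t : a t 0 = 1 := rcoef_prod_XsubC0 t.
have recl (F : nat -> K) : \sum_(i < k.+1) F i = F 0%N + \sum_(i < k) F i.+1.
  by rewrite big_ord_recl; congr (_ + _); apply: eq_bigr => i _; rewrite lift0.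
rewrite (recl (fun i => a (z :: s) i * pw (z :: s) (k.+1 - i))) a0 mul1r subn0 aS.
have -> : \sum_(i < k) a (z :: s) i.+1 * pw (z :: s) (k.+1 - i.+1) =
    \sum_(i < k) a s i.+1 * pw s (k - i) - z * \sum_(i < k) a s i * pw s (k - i)
    + (\sum_(i < k) a s i.+1 * z ^+ (k - i)
       - \sum_(i < k) a s i * z ^+ (k.+1 - i)).
  rewrite mulr_sumr -!sumrB -big_split; apply: eq_bigr => i _ /=.
  rewrite aS subSS /pw big_cons subSn 1?ltnW // exprS; ring.
(* Telescoping in [b i = a s i * z ^+ (k.+1 - i)]: the difference is [b k - b 0]. *)
have -> : \sum_(i < k) a s i.+1 * z ^+ (k - i) - \sum_(i < k) a s i * z ^+ (k.+1 - i)
    = z * a s k - z ^+ k.+1.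
  have := recl (fun i => a s i * z ^+ (k.+1 - i)).
  rewrite big_ord_recr /= a0 subn0 subSnn expr1 mul1r.
  under [X in _ = _ + X]eq_bigr do rewrite subSS.
  by move=> e; apply/eqP; rewrite subr_eq addrAC [z * _]mulrC [_ * z + _]addrC e
     addrAC subrr add0r.
rewrite /pw big_cons -/(pw s k.+1).
have := IHs k.+1; rewrite (recl (fun i => a s i * pw s (k.+1 - i))) a0 subn0 mul1r.
under eq_bigr do rewrite subSS.
set A := \sum_(i < k) _ => eA.
have := IHs k; set B := \sum_(i < k) _ => eB.
rewrite (_ : _ + _ = (k.+1%:R * a s k.+1 + (pw s k.+1 + A))
                     - z * (k%:R * a s k + B)); last by rewrite -natr1; ring.
by rewrite eA eB mulr0 subr0.
Qed.

End Newton.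

(** * Power sums of the roots of a monic polynomial *)

Section PowerSum.
Variable (R : realType).
Implicit Types p q : {poly R[i]}.

Lemma monic_prod_roots p : p \is monic ->
  p = \prod_(z <- roots_mult p) ('X - z%:P).
Proof.
move=> /monicP p1; rewrite /roots_mult.
by case: closed_field_poly_normal => s /= {1}->; rewrite p1 scale1r.
Qed.

(** By unique factorization, the roots of a product are those of the factors put together. *)
Lemma root_power_sumM k p q : p \is monic -> q \is monic ->
  root_power_sum k (p * q) = root_power_sum k p + root_power_sum k q.
Proof.
move=> pm qm; rewrite /root_power_sum -big_cat /=; apply: perm_big.
apply: prod_XsubC_eq; rewrite big_cat /= -!monic_prod_roots //.
by rewrite monicMl.
Qed.

Lemma root_power_sum1 k : root_power_sum k (1 : {poly R[i]}) = 0.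
Proof.
have := @root_power_sumM k 1 1 (monic1 _) (monic1 _).
by rewrite mulr1 => /eqP; rewrite -subr_eq0 opprD addNKr oppr_eq0 => /eqP.
Qed.

(** Hence the factor ['X] in 2-multiplicativity is invisible to the power sums; for [k = 0] it would
    count as 1. *)
Lemma root_power_sumX k : (0 < k)%N -> root_power_sum k ('X : {poly R[i]}) = 0.
Proof.
move=> k0; rewrite /root_power_sum.
have : perm_eq (roots_mult ('X : {poly R[i]})) [:: 0].
  by apply: prod_XsubC_eq; rewrite -monic_prod_roots ?monicX // big_seq1 subr0.
by move=> e; rewrite (perm_big _ e) big_seq1 expr0n gtn_eqF.
Qed.

Lemma newton_root_power_sum p n k : p \is monic -> size p = n.+1 ->
  k%:R * rcoef n k p + \sum_(i < k) rcoef n i p * root_power_sum (k - i) p = 0.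
Proof.
move=> pm sp; have := newton_prod_XsubC (roots_mult p) k.
rewrite -monic_prod_roots //.
suff -> : size (roots_mult p) = n by [].
by move: sp; rewrite {1}(monic_prod_roots pm) size_prod_XsubC => -[].
Qed.

End PowerSum.

(** A nonzero difference would vanish at more distinct integers than its degree allows. This turns
    the exponential identity, stated on values, into one of polynomials. *)
Lemma eq_poly_horner (K : numDomainType) (p q : {poly K}) :
  (forall x, p.[x] = q.[x]) -> p = q.
Proof.
move=> e; apply/eqP; rewrite -subr_eq0; apply/negPn/negP => nz.
pose rs : seq K := [seq i%:R | i <- iota 0 (size (p - q))].
have rsr : all (root (p - q)) rs.
  by apply/allP => x _; rewrite rootE hornerD hornerN e subrr.
have urs : uniq rs.
  by rewrite map_inj_uniq ?iota_uniq // => i j /eqP; rewrite eqr_nat => /eqP.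
by have := max_poly_roots nz rsr urs; rewrite size_map size_iota ltnn.
Qed.


(** * Moebius coefficients of graph invariants *)

Section Isomorphism.
Implicit Types G : sgraph.

Lemma isomorphic_sym G1 G2 : isomorphic G1 G2 -> isomorphic G2 G1.
Proof.
case=> h [[h' hK h'K] hE]; exists h'; split; first by exists h.
move=> e; rewrite -hE -imset_comp.
by rewrite (eq_imset (g := id)) ?imset_id // => x /=; rewrite h'K.
Qed.

Lemma isomorphic_trans G1 G2 G3 :
  isomorphic G1 G2 -> isomorphic G2 G3 -> isomorphic G1 G3.
Proof.
case=> h [hb hE] [h' [hb' hE']]; exists (h' \o h); split; first exact: bij_comp.
by move=> e; rewrite imset_comp hE' hE.
Qed.

Lemma isomorphic_card G1 G2 : isomorphic G1 G2 -> #|G1| = #|G2|.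
Proof. by case=> h [hb _]; apply: bij_eq_card hb. Qed.

Lemma subgraph_isomorphic G1 G2 (h : G1 -> G2) (W : {set G1}) F1 F2 :
  injective h ->
  (forall e : {set G1}, e \subset W ->
     (h @: e \in F2 :&: edges G2) = (e \in F1 :&: edges G1)) ->
  isomorphic (subgraph W F1) (subgraph (h @: W) F2).
Proof.
move=> h_inj hE.
pose h' (x : {x | x \in W}) : {y | y \in h @: W} :=
  Sub (h (val x)) (imset_f h (valP x)).
exists h'; split.
  apply: inj_card_bij => [x y /(congr1 val) /= /h_inj /val_inj //|].
  by rewrite !card_sig; apply: leq_imset_card.
move=> e; rewrite !(inE, in_setI).
have -> : val @: (h' @: e) = h @: (val @: e).
  by rewrite -!imset_comp; apply: eq_imset.
have := hE (val @: e); rewrite !inE => -> //.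
by apply/subsetP => _ /imsetP[x _ ->]; apply: valP.
Qed.

Lemma subgraph_isomorphicT G : isomorphic G (subgraph [set: G] (edges G)).
Proof.
exists (fun x => Sub x (in_setT x)); split.
  by exists val => [x|x] //; apply: val_inj.
move=> e; rewrite !inE -imset_comp (eq_imset (g := id)) ?imset_id ?andbb //.
Qed.

Lemma subgraph_isomorphic_id G (W : {set G}) F1 F2 :
  (forall e : {set G}, e \subset W ->
     (e \in F2 :&: edges G) = (e \in F1 :&: edges G)) ->
  isomorphic (subgraph W F1) (subgraph W F2).
Proof.
move=> e12; rewrite -{2}(imset_id W); apply: subgraph_isomorphic => // e.
by rewrite imset_id; apply: e12.
Qed.

Lemma card_subgraph G (W : {set G}) F : #|subgraph W F| = #|W|.
Proof. by rewrite card_sig. Qed.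

End Isomorphism.

(** * Subgraphs as sets of cells *)

Section Cells.
Variable G : sgraph.
Implicit Types (S T : {set G + {set G}}) (W : {set G}) (F : {set {set G}}).

(** A cell [inr e] may be any set of vertices, edge or not, so that all sets of cells form a Boolean
    lattice; [subgraph] drops what does not fit. *)
Definition vpart S : {set G} := [set x | inl x \in S].
Definition epart S : {set {set G}} := [set e | inr e \in S].
Definition cell_set W F : {set G + {set G}} :=
  [set c | match c with inl x => x \in W | inr e => e \in F end].

Lemma vpart_cell W F : vpart (cell_set W F) = W.
Proof. by apply/setP => x; rewrite !inE. Qed.

Lemma epart_cell W F : epart (cell_set W F) = F.
Proof. by apply/setP => x; rewrite !inE. Qed.

Lemma cell_setK S : cell_set (vpart S) (epart S) = S.
Proof. by apply/setP => -[x|e]; rewrite !inE. Qed.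

Lemma sub_cell_set S W F :
  (S \subset cell_set W F) = (vpart S \subset W) && (epart S \subset F).
Proof.
apply/subsetP/andP => [sS|[/subsetP sW /subsetP sF] [x|e] cS].
- by split; apply/subsetP => x; rewrite inE => /sS; rewrite inE.
- by rewrite inE sW // inE.
- by rewrite inE sF // inE.
Qed.

Lemma vpartI S T : vpart (S :&: T) = vpart S :&: vpart T.
Proof. by apply/setP => x; rewrite !inE. Qed.

Lemma epartI S T : epart (S :&: T) = epart S :&: epart T.
Proof. by apply/setP => x; rewrite !inE. Qed.

Lemma vpartU S T : vpart (S :|: T) = vpart S :|: vpart T.
Proof. by apply/setP => x; rewrite !inE. Qed.

Lemma epartU S T : epart (S :|: T) = epart S :|: epart T.
Proof. by apply/setP => x; rewrite !inE. Qed.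

Lemma vpart1r (e : {set G}) : vpart [set inr e] = set0.
Proof. by apply/setP => x; rewrite !inE. Qed.

Lemma epart1r (e : {set G}) : epart [set inr e] = [set e].
Proof. by apply/setP => x; rewrite !inE. Qed.

End Cells.

Definition full_cells (G : sgraph) := cell_set [set: G] (edges G).

(** * Expansion of an invariant over all subgraphs *)

Section SubgraphMobius.
Variables (K : comNzRingType) (g : sgraph -> K).
Hypothesis g_iso : forall G1 G2, isomorphic G1 G2 -> g G1 = g G2.

Definition on_cells (G : sgraph) (S : {set G + {set G}}) : K :=
  g (subgraph (vpart S) (epart S)).

Definition mobius_coef (G : sgraph) : K := mobius (@on_cells G) (full_cells G).

Definition cell_map (G1 G2 : sgraph) (h : G1 -> G2) (c : G1 + {set G1}) :
    G2 + {set G2} :=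
  match c with inl x => inl (h x) | inr e => inr (h @: e) end.

Lemma cell_map_inj (G1 G2 : sgraph) (h : G1 -> G2) :
  injective h -> injective (cell_map h).
Proof.
move=> h_inj [x|e] [y|e'] //= []; first by move/h_inj->.
by move/(imset_inj h_inj) => ->.
Qed.

Lemma vpart_cell_map (G1 G2 : sgraph) (h : G1 -> G2) (S : {set G1 + {set G1}}) :
  vpart (cell_map h @: S) = h @: vpart S.
Proof.
apply/setP => y; rewrite inE; apply/imsetP/imsetP.
  by case=> -[x|e] //= xS [->]; exists x; rewrite ?inE.
by case=> x; rewrite inE => xS ->; exists (inl x).
Qed.

Lemma epart_cell_map (G1 G2 : sgraph) (h : G1 -> G2) (S : {set G1 + {set G1}}) :
  epart (cell_map h @: S) = (fun e : {set G1} => h @: e) @: epart S.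
Proof.
apply/setP => y; rewrite inE; apply/imsetP/imsetP.
  by case=> -[x|e] //= xS [->]; exists e; rewrite ?inE.
by case=> x; rewrite inE => xS ->; exists (inr x).
Qed.

Lemma mobius_cell_map (G1 G2 : sgraph) (h : G1 -> G2) (S : {set G1 + {set G1}}) :
  injective h ->
  (forall e, e \in epart S -> (e \in edges G1) && (h @: e \in edges G2)) ->
  mobius (@on_cells G1) S = mobius (@on_cells G2) (cell_map h @: S).
Proof.
move=> h_inj hS; apply: mobius_imset; first exact: cell_map_inj.
move=> T /subsetP TS; rewrite /on_cells vpart_cell_map epart_cell_map.
apply/g_iso/subgraph_isomorphic => // e _; rewrite !in_setI.
rewrite (mem_imset _ _ (imset_inj h_inj)).
case eT: (e \in epart T) => //=.
have /hS/andP[-> ->] // : e \in epart S.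
by move: eT; rewrite !inE => /TS.
Qed.

Lemma mobius_coef_iso G1 G2 : isomorphic G1 G2 -> mobius_coef G1 = mobius_coef G2.
Proof.
case=> h [hb hE]; rewrite /mobius_coef (@mobius_cell_map _ G2 h); first last.
- by move=> e; rewrite epart_cell hE => ->.
- exact: bij_inj.
congr mobius; rewrite -[LHS]cell_setK vpart_cell_map epart_cell_map.
rewrite vpart_cell epart_cell; case: hb => h' hK h'K; congr cell_set.
  by apply/setP => y; rewrite inE -[y]h'K imset_f ?inE.
have imK (e : {set G2}) : h @: (h' @: e) = e.
  by rewrite -imset_comp (eq_imset (g := id)) ?imset_id // => x /=; rewrite h'K.
apply/setP => e; apply/imsetP/idP => [[e' e'E ->]|eE]; first by rewrite hE.
by exists (h' @: e); rewrite ?imK // -hE imK.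
Qed.

(** The coefficient does not depend on the ambient graph: the inclusion of the subgraph carries its
    cells onto [cell_set W F] and preserves [on_cells]. *)
Lemma mobius_coef_subgraph (G : sgraph) (W : {set G}) (F : {set {set G}}) :
  is_subgraph W F ->
  mobius (@on_cells G) (cell_set W F) = mobius_coef (subgraph W F).
Proof.
case/andP=> /subsetP FE /forall_inP FW.
rewrite /mobius_coef (@mobius_cell_map (subgraph W F) G (val : {x | x \in W} -> G)); first last.
- by move=> e; rewrite epart_cell => eE; rewrite eE; move: eE; rewrite !inE; case/andP.
- exact: val_inj.
congr mobius; rewrite -[RHS]cell_setK vpart_cell_map epart_cell_map.
rewrite vpart_cell epart_cell; congr cell_set.
  apply/setP => x; apply/idP/imsetP => [xW|[y _ ->]]; last exact: valP.
  by exists (Sub x xW).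
apply/setP => e; apply/idP/imsetP => [eF|[y + ->]]; last by rewrite !inE => /andP[].
have E : val @: [set x : {x | x \in W} | val x \in e] = e.
  apply/setP => x; apply/imsetP/idP => [[y + ->]|xe]; first by rewrite inE.
  by exists (Sub x (subsetP (FW _ eF) _ xe)); rewrite ?inE.
by exists [set x : {x | x \in W} | val x \in e]; rewrite ?inE E // eF FE.
Qed.

(** An edge cell with an end outside [vpart S] is dropped in every subset of [S], so [on_cells]
    ignores it and the coefficient vanishes. *)
Lemma mobius_on_cells_sub (G : sgraph) (S : {set G + {set G}}) :
  mobius (@on_cells G) S != 0 -> forall e, e \in epart S -> e \subset vpart S.
Proof.
move=> nz e eS; apply: contra_neqT nz => eV.
apply: (@mobius_indep _ _ (inr e)); first by move: eS; rewrite inE.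
move=> T TS _; rewrite /on_cells vpartU epartU vpart1r epart1r set0U.
apply/g_iso/subgraph_isomorphic_id => e' e'T; rewrite !inE; case: eqP => //= ee'.
have TV : vpart T \subset vpart S.
  by move: TS; rewrite -{1}[S]cell_setK sub_cell_set => /andP[].
by move: eV; rewrite -ee' (subset_trans e'T TV).
Qed.

Lemma sum_mobius_coef G :
  g G = \sum_(S : {set G} * {set {set G}} | is_subgraph S.1 S.2)
          mobius_coef (subgraph S.1 S.2).
Proof.
rewrite (g_iso (subgraph_isomorphicT G)).
have -> : g (subgraph [set: G] (edges G)) = on_cells (full_cells G).
  by rewrite /on_cells vpart_cell epart_cell.
rewrite (mobius_inv (@on_cells G)).
rewrite (reindex (fun S : {set G} * {set {set G}} => cell_set S.1 S.2)) /=; last first.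
  exists (fun S => (vpart S, epart S)) => [[W F]|S] _ /=; last exact: cell_setK.
  by rewrite vpart_cell epart_cell.
rewrite [RHS]big_mkcond; apply: eq_bigr => -[W F] _ /=.
rewrite sub_cell_set vpart_cell epart_cell subsetT /=.
(* A pair that is not a subgraph either sticks out of [full_cells G] or has coefficient 0. *)
case: ifPn => [sub|nsub].
  by rewrite mobius_coef_subgraph //; case/andP: sub => -> _; rewrite mulr1.
case: (boolP (F \subset edges G)) => FE; last by rewrite mulr0.
rewrite mulr1; apply: contraNeq nsub => /mobius_on_cells_sub.
rewrite vpart_cell epart_cell => FW.
by rewrite /is_subgraph FE; apply/forall_inP.
Qed.

End SubgraphMobius.


(** * Power sums of 2-multiplicative polynomials *)

Section TwoMultiplicative.
Variables (R : realType) (f : sgraph -> {poly R[i]}).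
Hypotheses (f_iso : iso_invariant f) (f_monic : monic_graph_poly f).
Hypotheses (f_exp : exponential_type f) (f_2mult : two_multiplicative f).
Variables (k : nat) (k_gt0 : (0 < k)%N).

Let p (G : sgraph) : R[i] := root_power_sum k (f G).

Lemma power_sum_iso G1 G2 : isomorphic G1 G2 -> p G1 = p G2.
Proof. by rewrite /p => /f_iso ->. Qed.

(** A one-vertex graph is the union of two copies of itself sharing that vertex, so
    ['X * f G = f G * f G] and [f G = 'X]. *)
Lemma power_sum_small (G : sgraph) : (#|G| <= 1)%N -> p G = 0.
Proof.
rewrite /p; case En: #|G| => [|[|n]] // _.
  by rewrite (proj1 f_exp) // root_power_sum1.
have := proj2 f_2mult G [set: G] [set: G] (edges G) (edges G).
rewrite -(f_iso (subgraph_isomorphicT G)) setIid cardsT => /(_ _ En) e.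
suff <- : 'X = f G by apply: root_power_sumX.
apply: (mulIf (monic_neq0 (proj1 (f_monic G)))); apply: e.
have sub : is_subgraph [set: G] (edges G).
  by rewrite /is_subgraph subxx; apply/forall_inP => e _; apply: subsetT.
by split; rewrite ?setUid.
Qed.

Lemma power_sum_union (G : sgraph) (W1 W2 : {set G}) F1 F2 :
  is_union W1 W2 F1 F2 -> (#|W1 :&: W2| <= 1)%N ->
  p G = p (subgraph W1 F1) + p (subgraph W2 F2).
Proof.
move=> U; rewrite /p; case E: #|W1 :&: W2| => [|[|n]] // _.
  by rewrite (proj1 f_2mult _ _ _ _ _ U E) root_power_sumM ?(proj1 (f_monic _)).
have := congr1 (root_power_sum k) (proj2 f_2mult _ _ _ _ _ U E).
rewrite !root_power_sumM ?(proj1 (f_monic _)) ?monicX //.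
by rewrite root_power_sumX // add0r.
Qed.

(** A decomposition of [G] cuts each [subgraph W F] into two parts that still share at most one
    vertex. All [W] and [F] are needed, as the transform sums over all sets of cells. *)
Lemma power_sum_subgraph_union (G : sgraph) (W1 W2 W : {set G}) F1 F2 F :
  is_union W1 W2 F1 F2 -> (#|W1 :&: W2| <= 1)%N ->
  p (subgraph W F)
  = p (subgraph (W :&: W1) (F :&: F1)) + p (subgraph (W :&: W2) (F :&: F2)).
Proof.
case=> /andP[_ /forall_inP FW1] /andP[_ /forall_inP FW2] W12 F12 cardI.
pose v (x : {x | x \in W}) : G := val x.
have v_inj : injective v by exact: val_inj.
pose Wr (Wi : {set G}) : {set subgraph W F} := v @^-1: Wi.
pose Fr (Fi : {set {set G}}) : {set {set subgraph W F}} :=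
  [set e : {set {x | x \in W}} | v @: e \in F :&: Fi :&: edges G].
have vWr Wi : v @: Wr Wi = W :&: Wi.
  apply/setP => x; rewrite inE; apply/imsetP/andP.
    by case=> y; rewrite inE => yW ->; split=> //; apply: valP.
  by case=> xW xWi; exists (Sub x xW); rewrite ?inE.
have sub (Wi : {set G}) (Fi : {set {set G}}) : (forall e, e \in Fi -> e \subset Wi) -> is_subgraph (Wr Wi) (Fr Fi).
  move=> FWi; apply/andP; split.
    by apply/subsetP => e; rewrite !inE => /andP[/andP[-> _] ->].
  apply/forall_inP => e; rewrite !inE => /andP[/andP[_ /FWi /subsetP eW] _].
  by apply/subsetP => x xe; rewrite inE eW // imset_f.
have iso Wi Fi :
    isomorphic (subgraph (Wr Wi) (Fr Fi)) (subgraph (W :&: Wi) (F :&: Fi)).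
  rewrite -vWr; apply: subgraph_isomorphic => // e _; rewrite !inE -/v.
  by case: (v @: e \in F); case: (v @: e \in Fi); case: (v @: e \in edges G).
rewrite -(power_sum_iso (iso W1 F1)) -(power_sum_iso (iso W2 F2)).
apply: power_sum_union; first split; [exact: sub|exact: sub| | |].
- by apply/setP => x; have := in_setT (v x); rewrite -W12 !inE.
- apply/setP => e; rewrite !inE -/v -F12 inE.
  by case: (v @: e \in F); case: (v @: e \in F1); case: (v @: e \in F2).
rewrite -(card_imset _ v_inj) (leq_trans _ cardI) // subset_leq_card //.
by apply/subsetP => _ /imsetP[x + ->]; rewrite !inE.
Qed.

(** [on_cells p] is a sum of two functions, each seeing only the cells of one part, and neither part
    contains all cells of [G]. *)
Lemma mobius_coef_union0 (G : sgraph) (W1 W2 : {set G}) F1 F2 :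
  is_union W1 W2 F1 F2 -> (#|W1 :&: W2| <= 1)%N ->
  W1 != [set: G] -> W2 != [set: G] -> mobius_coef p G = 0.
Proof.
move=> U cardI nW1 nW2; rewrite /mobius_coef.
rewrite (eq_mobius (psi := fun T => on_cells p (T :&: cell_set W1 F1)
                                    + on_cells p (T :&: cell_set W2 F2))).
  rewrite mobiusD !mobius_restrict !sub_cell_set !vpart_cell !subTset.
  by rewrite (negbTE nW1) (negbTE nW2) !mulr0 addr0.
move=> T _; rewrite /on_cells !vpartI !epartI !vpart_cell !epart_cell.
exact: power_sum_subgraph_union.
Qed.

(** The parts are the graphs induced on [C :|: U] and on the complement of [C]: an edge meeting [C]
    stays in [C :|: U]. An empty [U] serves disconnected graphs, a singleton serves cut vertices. *)
Lemma mobius_coef_cut0 (G : sgraph) (C U : {set G}) (x y : G) :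
  (#|U| <= 1)%N -> x \in C -> y \notin C :|: U ->
  (forall a b, a \in C -> adj a b -> b \in C :|: U) -> mobius_coef p G = 0.
Proof.
move=> cardU xC yCU CU.
pose E (W : {set G}) := [set e in edges G | e \subset W].
have sub W : is_subgraph W (E W).
  apply/andP; split; first by apply/subsetP => e; rewrite inE => /andP[].
  by apply/forall_inP => e; rewrite inE => /andP[].
apply: (@mobius_coef_union0 G (C :|: U) (~: C) (E (C :|: U)) (E (~: C))).
- split=> //; first by apply/setP => z; rewrite !inE orbAC orbN.
  apply/setP => e; rewrite !inE -andb_orr; case: (boolP (e \in edges G)) => //= eE.
  case: (boolP (e \subset ~: C)) => [|/subsetPn[a ae]]; first by rewrite orbT.
  rewrite inE negbK orbF => aC; apply/subsetP => b be.
  have [->|neab] := eqVneq b a; first by rewrite inE aC.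
  apply: (CU a) => //; rewrite /adj.
  suff -> : [set a; b] = e by [].
  apply/eqP; rewrite eqEcard subUset !sub1set ae be cards2 eq_sym neab /=.
  by rewrite (card_edges eE).
- apply: leq_trans cardU; apply/subset_leq_card/subsetP => z; rewrite !inE.
  by case/andP => /orP[->|].
- by apply/eqP => /setP/(_ y); rewrite (negbTE yCU) inE.
- by apply/eqP => /setP/(_ x); rewrite !inE xC.
Qed.

Lemma mobius_coef_not_two_connected (G : sgraph) :
  ~ two_connected G -> mobius_coef p G = 0.
Proof.
move=> n2G; have [small|big] := leqP #|G| 1.
  rewrite /mobius_coef /mobius big1 // => T _.
  by rewrite /on_cells power_sum_small ?mulr0 // card_subgraph (leq_trans (max_card _)).
have [cG|] := pselect (forall x y : G, connect (@adj G) x y); last first.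
  move=> /existsNP[x /existsNP[y /negP nxy]].
  apply: (@mobius_coef_cut0 G [set z | connect (@adj G) x z] set0 x y).
  - by rewrite cards0.
  - by rewrite inE connect0.
  - by rewrite setU0 inE.
  - by move=> a b; rewrite setU0 !inE => xa ab; apply: connect_trans xa (connect1 ab).
have [v] : exists v : G, ~ connected (induced (~: [set v])).
  apply/existsNP => c; apply: n2G; split=> //; split=> //; exact: ltnW.
(* Excludes that [G - v] fails to be connected merely by being empty. *)
have vgt0 : (0 < #|induced (~: [set v])|)%N.
  by rewrite card_subgraph cardsC1 -subn1 subn_gt0.
have [cv|+ _] := pselect (forall x y : induced (~: [set v]),
    connect (@adj (induced (~: [set v]))) x y); first by case.
move=> /existsNP[x /existsNP[y /negP nxy]].
pose c := connect (@adj (induced (~: [set v]))).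
(* [C] is the component of [x] in [G - v], mapped back into [G]. *)
apply: (@mobius_coef_cut0 G
  [set val z | z in [set z : {z | z \in ~: [set v]} | c x z]] [set v] (val x) (val y)).
- by rewrite cards1.
- by rewrite imset_f // inE /c connect0.
- rewrite inE negb_or mem_imset ?inE ?[~~ c _ _]nxy //=; last exact: val_inj.
  by have := valP y; rewrite !inE.
- move=> _ b /imsetP[a + ->]; rewrite !inE => xa ab.
  case: (eqVneq b v) => [|nbv]; first by rewrite orbT.
  have bP : b \in ~: [set v] by rewrite !inE.
  rewrite orbF; apply/imsetP; exists (Sub b bP) => //; rewrite inE.
  apply: connect_trans xa (connect1 _); rewrite /adj inE setIid.
  by rewrite imsetU1 imset_set1.
Qed.

End TwoMultiplicative.


(** * The rank filtration *)

Section Rank.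
Variables (K : numFieldType) (G : sgraph).
Implicit Types (S T : {set G + {set G}}) (phi psi : {set G + {set G}} -> K).

(** An edge xy is represented by the difference of the unit vectors of its ends; the rank becomes
    the dimension of a span, which is subadditive under unions. *)
Definition unit_vec (x : G) : 'rV[K]_#|G| := delta_mx 0 (enum_rank x).

(* The graphic matroid rank of the edge cells of T is at most j. *)
Definition rank_le (j : nat) T : Prop :=
  exists2 U : {vspace 'rV[K]_#|G|}, (\dim U <= j)%N &
    forall x y : G, [set x; y] \in epart T -> unit_vec x - unit_vec y \in U.

Lemma rank_leU i j S T : rank_le i S -> rank_le j T -> rank_le (i + j) (S :|: T).
Proof.
case=> [U dU US] [V dV VT]; exists (U + V)%VS.
  by rewrite (leq_trans (dimv_add_leqif _ _)) // leq_add.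
move=> x y; rewrite epartU inE => /orP[/US|/VT] m.
  exact: subvP (addvSl _ _) _ m.
exact: subvP (addvSr _ _) _ m.
Qed.

Lemma rank_le_set0 : rank_le 0 set0.
Proof. by exists 0%VS => [|x y]; rewrite ?dimv0 // !inE. Qed.

(** Fixing [b] in [B], the [#|B| - 1] differences with [unit_vec b] span all the others. *)
Lemma rank_le_block j T (B : {set G}) :
  (0 < #|B| <= j.+1)%N -> (forall e, e \in epart T -> e \subset B) -> rank_le j T.
Proof.
case/andP=> /card_gt0P[b bB] cardB TB.
exists <<[seq unit_vec x - unit_vec b | x <- enum (B :\ b)]>>%VS.
  rewrite (leq_trans (dim_span _)) // size_map -cardE.
  by move: cardB; rewrite (cardsD1 b) bB.
have mem x : x \in B ->
    unit_vec x - unit_vec b \in <<[seq unit_vec x - unit_vec b | x <- enum (B :\ b)]>>%VS.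
  move=> xB; have [->|nxb] := eqVneq x b; first by rewrite subrr mem0v.
  by apply: memv_span; apply/mapP; exists x; rewrite // mem_enum !inE nxb.
move=> x y /TB; rewrite subUset !sub1set => /andP[/mem xU /mem yU].
have -> : unit_vec x - unit_vec y
    = (unit_vec x - unit_vec b) - (unit_vec y - unit_vec b).
  by rewrite opprB addrA subrK.
exact: rpredB.
Qed.

(** Following paths from [x0], every unit vector lies in [U + <[unit_vec x0]>], which is therefore
    the whole space. *)
Lemma rank_le_connected j : connected G -> rank_le j (full_cells G) -> (#|G| <= j.+1)%N.
Proof.
case=> /card_gt0P[x0 _] cG [U dU UE].
have mem y : unit_vec y \in (U + <[unit_vec x0]>)%VS.
  have /connectP[q] := cG x0 y; elim/last_ind: q y => [|q z IHq] y.
    by move=> _ ->; apply: subvP (addvSr _ _) _ (memv_line _).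
  rewrite rcons_path last_rcons => /andP[/IHq IH adjz] ->.
  rewrite -[unit_vec z](subrK (unit_vec (last x0 q))) rpredD ?IH //.
  apply: subvP (addvSl _ _) _ _; apply: UE; rewrite epart_cell setUC.
  exact: adjz.
have fU : (fullv <= U + <[unit_vec x0]>)%VS.
  apply/subvP => u _; rewrite [u]row_sum_delta rpred_sum // => i _.
  by rewrite rpredZ // -(enum_valK i); apply: mem.
have : (#|G| <= \dim (U + <[unit_vec x0]>))%N.
  apply: leq_trans (dimvS fU).
  by rewrite dimvf dim_matrix; apply/eq_leq/esym/mul1n.
move=> /leq_trans -> //.
by rewrite (leq_trans (dimv_add_leqif _ _)) // dim_vline -[j.+1]addn1 leq_add // leq_b1.
Qed.

(** The j-th step of the filtration: combinations of indicators of sets of rank at most [j]. *)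
Definition mobius_rank_le (j : nat) phi : Prop :=
  forall T, mobius phi T != 0 -> rank_le j T.

Lemma eq_mobius_rank_le j phi psi :
  phi =1 psi -> mobius_rank_le j phi -> mobius_rank_le j psi.
Proof. by move=> e H T; rewrite -(eq_mobius (phi := phi)) // => ?; apply: H. Qed.

Lemma mobius_rank_le_sum j (I : finType) (P : pred I) (F : I -> {set G + {set G}} -> K) :
  (forall i, P i -> mobius_rank_le j (F i)) ->
  mobius_rank_le j (fun T => \sum_(i | P i) F i T).
Proof.
move=> H T; rewrite mobius_sum => nz.
have [i Pi nzi] : exists2 i, P i & mobius (F i) T != 0.
  apply/exists_inP; apply: contraNT nz => /exists_inPn z; rewrite big1 // => i /z.
  by rewrite negbK => /eqP.
exact: H nzi.
Qed.

Lemma mobius_rank_leZ j a phi :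
  mobius_rank_le j phi -> mobius_rank_le j (fun T => a * phi T).
Proof. by move=> H T; rewrite mobiusZ mulf_eq0 negb_or => /andP[_ /H]. Qed.

Lemma mobius_rank_leD j phi psi :
  mobius_rank_le j phi -> mobius_rank_le j psi ->
  mobius_rank_le j (fun T => phi T + psi T).
Proof.
move=> H1 H2 T; rewrite mobiusD; have [->|/H1 //] := eqVneq (mobius phi T) 0.
by rewrite add0r => /H2.
Qed.

Lemma mobius_rank_leM i j phi psi :
  mobius_rank_le i phi -> mobius_rank_le j psi ->
  mobius_rank_le (i + j) (fun T => phi T * psi T).
Proof.
move=> H1 H2 T; rewrite mobiusM => nz.
have [[T1 T2] /= /eqP <- nzi] : exists2 V : {set G + {set G}} * {set G + {set G}},
    V.1 :|: V.2 == T & mobius phi V.1 * mobius psi V.2 != 0.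
  apply/exists_inP; apply: contraNT nz => /exists_inPn z; rewrite big1 // => V /z.
  by rewrite negbK => /eqP.
by move: nzi; rewrite mulf_eq0 negb_or => /andP[/H1 r1 /H2 r2]; apply: rank_leU.
Qed.

Lemma mobius_rank_le_restrict j phi S :
  mobius_rank_le j phi -> mobius_rank_le j (fun T => phi (T :&: S)).
Proof.
by move=> H T; rewrite mobius_restrict mulf_eq0 negb_or => /andP[/H].
Qed.

Lemma mobius_rank_le_const a : mobius_rank_le 0 (fun=> a).
Proof.
move=> T nz; suff -> : T = set0 by apply: rank_le_set0.
apply/eqP; apply: contraNT nz => /set0Pn[x xT].
by rewrite (mobius_indep xT).
Qed.

End Rank.


(** * Rank bounds for the coefficients and power sums *)

Section ExponentialType.
Variables (R : realType) (f : sgraph -> {poly R[i]}).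
Hypotheses (f_iso : iso_invariant f) (f_monic : monic_graph_poly f).
Hypothesis (f_exp : exponential_type f).

(** For fixed y, compare the coefficients of x in the exponential identity; on the side of f(G, x +
    y) it is f'(G, y). *)
Lemma deriv_exponential (G : sgraph) :
  (f G)^`() = \sum_(S : {set G}) (f (induced S))`_1 *: f (induced (~: S)).
Proof.
apply: eq_poly_horner => y.
have e : f G \Po ('X + y%:P)
    = \sum_(S : {set G}) (f (induced (~: S))).[y] *: f (induced S).
  apply: eq_poly_horner => x; rewrite horner_comp hornerD hornerX hornerC.
  rewrite -(proj2 f_exp) horner_sum; apply: eq_bigr => S _.
  by rewrite hornerZ mulrC.
have := congr1 (fun q : {poly R[i]} => q`_1) e.
have c1 (q : {poly R[i]}) : q`_1 = q^`().[0].
  by rewrite horner_coef0 coef_deriv mulr1n.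
rewrite /= c1 deriv_comp derivD derivX derivC addr0 mulr1 horner_comp hornerD.
rewrite hornerX hornerC add0r => ->.
rewrite coef_sum horner_sum; apply: eq_bigr => S _.
by rewrite coefZ hornerZ mulrC.
Qed.

Lemma deriv_subgraph (G : sgraph) (W : {set G}) (F : {set {set G}}) :
  (f (subgraph W F))^`()
  = \sum_(B : {set G} | B \subset W) (f (subgraph B F))`_1 *: f (subgraph (W :\: B) F).
Proof.
pose v (x : {x | x \in W}) : G := val x.
have v_inj : injective v by exact: val_inj.
have iso (S : {set {x | x \in W}}) :
    isomorphic (@induced (subgraph W F) S) (subgraph (v @: S) F).
  by apply: (@subgraph_isomorphic (subgraph W F) G v) => // e _; rewrite !inE andbb.
have preK (S : {set {x | x \in W}}) : v @^-1: (v @: S) = S.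
  by apply/setP => x; rewrite inE mem_imset.
have vS (S : {set {x | x \in W}}) : v @: S \subset W.
  by apply/subsetP => _ /imsetP[x _ ->]; apply: valP.
have vC (S : {set {x | x \in W}}) : v @: (~: S) = W :\: v @: S.
  apply/setP => x; rewrite inE; apply/imsetP/andP => [[y + ->]|[xS xW]].
    by rewrite inE mem_imset // => ->; split=> //; apply: valP.
  by exists (Sub x xW) => //; rewrite inE; apply: contra xS; apply: imset_f.
rewrite deriv_exponential.
rewrite [RHS](reindex_onto (fun S : {set {x | x \in W}} => v @: S)
                           (fun B => v @^-1: B)) /=.
  apply: eq_big => [S|S _]; first by rewrite vS preK eqxx.
  by rewrite -vC -(f_iso (iso S)) -(f_iso (iso (~: S))).
move=> B /subsetP BW; apply/setP => x; apply/imsetP/idP => [[y + ->]|xB].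
  by rewrite inE.
by exists (Sub x (BW x xB)); rewrite ?inE.
Qed.

(** Up to the sign (-1)^j, the j-th elementary symmetric function of the roots. *)
Definition top_coef (j : nat) (G : sgraph) : R[i] := rcoef #|G| j (f G).

Lemma top_coef_iso j G1 G2 : isomorphic G1 G2 -> top_coef j G1 = top_coef j G2.
Proof. by move=> e; rewrite /top_coef (isomorphic_card e) (f_iso e). Qed.

Lemma top_coef0 (G : sgraph) : top_coef 0 G = 1.
Proof.
have [/monicP m s] := f_monic G.
by rewrite /top_coef /rcoef subn0 -m lead_coefE s.
Qed.

Lemma coef1_card0 (G : sgraph) : #|G| = 0%N -> (f G)`_1 = 0.
Proof. by move=> /(proj1 f_exp) ->; rewrite coef1. Qed.

Lemma coef1_card1 (G : sgraph) : #|G| = 1%N -> (f G)`_1 = 1.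
Proof. by have [/monicP + s] := f_monic G => + c; rewrite lead_coefE s c. Qed.

(** Compare the coefficients of x^(#|W| - j - 1) in [deriv_subgraph]. *)
Lemma top_coef_rec j (G : sgraph) (W : {set G}) (F : {set {set G}}) :
  (#|W|%:R - j%:R) * top_coef j (subgraph W F)
  = \sum_(B : {set G} | (B \subset W) && (0 < #|B| <= j.+1)%N)
      (f (subgraph B F))`_1 * top_coef (j.+1 - #|B|) (subgraph (W :\: B) F).
Proof.
rewrite /top_coef card_subgraph.
have cardD (B : {set G}) : B \subset W -> #|subgraph (W :\: B) F| = (#|W| - #|B|)%N.
  by move=> /setIidPr BW; rewrite card_subgraph cardsD BW.
(* For [j >= #|W|] both sides are 0: on the right the index [j.+1 - #|B|] exceeds the number of
   remaining vertices, on the left [j = #|W|] kills the factor and [j > #|W|] the coefficient. *)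
have [ltjW|leWj] := ltnP j #|W|; last first.
  rewrite [RHS]big1 => [|B /andP[BW /andP[B0 Bj]]]; last first.
    have := subset_leq_card BW; rewrite cardD // /rcoef => BW'.
    by rewrite ifN ?mulr0 //; lia.
  rewrite /rcoef; case: ifP => jW; last by rewrite mulr0.
  have -> : j = #|W| by lia.
  by rewrite subrr mul0r.
rewrite /rcoef ltnW // -natrB ?(ltnW ltjW) //.
have := congr1 (fun q : {poly R[i]} => q`_(#|W| - j.+1)) (deriv_subgraph W F).
rewrite /= coef_deriv coef_sum.
have -> : (#|W| - j.+1).+1 = (#|W| - j)%N by lia.
rewrite mulr_natl => ->; rewrite [RHS]big_mkcondr /=; apply: eq_bigr => B BW.
have BW' := subset_leq_card BW.
rewrite coefZ cardD //; case: ifP => [/andP[B0 Bj]|nB].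
  rewrite ifT; last by lia.
  by congr (_ * _`_ _); lia.
(* The empty block has linear coefficient 0; a block with more than [j.+1] vertices leaves a
   polynomial of too small degree. *)
case B0 : #|B| nB => [|m] /= nB.
  by rewrite coef1_card0 ?mul0r // card_subgraph.
rewrite [X in _ * X]nth_default ?mulr0 //.
by rewrite (proj2 (f_monic _)) cardD // B0; lia.
Qed.

(** The singleton blocks of [top_coef_rec] are moved to the left, where they combine with the factor
    [#|W|] into differences under deletion of a vertex. The blocks left on the right involve only
    coefficients of smaller index. *)
Lemma top_coef_rec_vertex j (G : sgraph) (S : {set G + {set G}}) :
  \sum_(v : G) (on_cells (top_coef j) S
                - on_cells (top_coef j) (S :&: ~: [set inl v]))
  - j%:R * on_cells (top_coef j) S
  = \sum_(B : {set G} | (1 < #|B| <= j.+1)%N)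
      ((B \subset vpart S)%:R * (f (subgraph B (epart S)))`_1) *
      on_cells (top_coef (j.+1 - #|B|)) (S :&: ~: cell_set B set0).
Proof.
have eC (T : {set G + {set G}}) : epart T = set0 ->
    epart (S :&: ~: T) = epart S.
  by move=> /setP e; apply/setP => x; have := e x; rewrite !inE => ->; rewrite andbT.
have vC (T : {set G + {set G}}) : vpart (S :&: ~: T) = vpart S :\: vpart T.
  by apply/setP => x; rewrite !inE andbC.
have e1 v : epart [set inl v : G + {set G}] = set0.
  by apply/setP => x; rewrite !inE.
have v1 v : vpart [set inl v : G + {set G}] = [set v].
  by apply/setP => x; rewrite !inE.
set W := vpart S; set F := epart S.
have singl : \sum_(v in W) top_coef j (subgraph (W :\ v) F)
    = \sum_(B : {set G} | (B \subset W) && (0 < #|B| <= j.+1)%N && (#|B| == 1%N))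
        (f (subgraph B F))`_1 * top_coef (j.+1 - #|B|) (subgraph (W :\: B) F).
  transitivity (\sum_(B in [set [set v] | v in W])
      (f (subgraph B F))`_1 * top_coef (j.+1 - #|B|) (subgraph (W :\: B) F)).
    rewrite big_imset /= => [|u v _ _ /set1_inj //]; apply: eq_bigr => v _.
    by rewrite cards1 subn1 coef1_card1 ?mul1r // card_subgraph cards1.
  apply: eq_bigl => B; apply/imsetP/idP => [[v vW ->]|/andP[/andP[BW _] /cards1P[v Bv]]].
    by rewrite sub1set vW cards1.
  by exists v => //; rewrite -sub1set -Bv.
have -> : \sum_(v : G) (on_cells (top_coef j) S
                - on_cells (top_coef j) (S :&: ~: [set inl v]))
    = #|W|%:R * top_coef j (subgraph W F)
      - \sum_(v in W) top_coef j (subgraph (W :\ v) F).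
  rewrite mulr_natl -sumr_const -sumrB [RHS]big_mkcond; apply: eq_bigr => v _.
  rewrite /on_cells vC v1 eC //; case: ifPn => // vW.
  suff -> : vpart S :\ v = W by rewrite subrr.
  by apply/setP => x; rewrite !inE; case: eqP vW => // -> /negbTE; rewrite inE => ->.
rewrite addrAC -mulrBl top_coef_rec (bigID (fun B : {set G} => #|B| == 1%N)) /=.
rewrite -singl addrC addrA addNr add0r [RHS](bigID (fun B : {set G} => B \subset W)) /=.
rewrite [X in _ = _ + X]big1 => [|B /andP[_ /negbTE BW]]; last by rewrite BW !mul0r.
rewrite addr0; apply: eq_big => [B|B /andP[/andP[BW _] _]].
  by case: (B \subset W) => //=; rewrite ?andbT ?andbF //; lia.
rewrite BW mul1r /on_cells vC eC ?vpart_cell //.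
by apply/setP => x; rewrite !inE.
Qed.

(* The left-hand side of top_coef_rec_vertex has Moebius coefficient #|vpart T| - j
   times that of e_j at T, so one may divide unless T has exactly j vertices, and
   then its rank is below j anyway. *)
Lemma top_coef_rank (G : sgraph) j :
  mobius_rank_le j (@on_cells R[i] (top_coef j) G).
Proof.
elim/ltn_ind: j => -[|j] IHj.
  apply: (eq_mobius_rank_le (phi := fun=> 1)); last exact: mobius_rank_le_const.
  by move=> S; rewrite /on_cells top_coef0.
(* This factor depends only on the edge cells inside [B], whose rank is at most [#|B| - 1]. *)
have blockdeg (B : {set G}) : (1 < #|B| <= j.+2)%N -> mobius_rank_le (#|B|.-1)
    (fun S : {set G + {set G}} =>
      (B \subset vpart S)%:R * (f (subgraph B (epart S)))`_1).
  move=> cardB T nz; apply: (@rank_le_block _ G _ T B); first by lia.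
  move=> e eT; apply: contra_neqT nz => eB.
  apply: (@mobius_indep _ _ (inr e)); first by move: eT; rewrite inE.
  move=> T' _ _; rewrite vpartU epartU vpart1r epart1r set0U.
  suff -> : f (subgraph B ([set e] :|: epart T')) = f (subgraph B (epart T')) by [].
  apply/f_iso/subgraph_isomorphic_id => e' e'B; rewrite !inE; case: eqP => //= ee'.
  by move: eB; rewrite -ee' e'B.
have rhsdeg : mobius_rank_le j.+1 (fun S : {set G + {set G}} =>
    \sum_(B : {set G} | (1 < #|B| <= j.+2)%N)
      ((B \subset vpart S)%:R * (f (subgraph B (epart S)))`_1) *
      on_cells (top_coef (j.+2 - #|B|)) (S :&: ~: cell_set B set0)).
  apply: mobius_rank_le_sum => B cardB.
  (* The ranks of the two factors add up to exactly [j.+1]; the induction hypothesis applies since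
     [#|B| >= 2]. *)
  have ej : j.+1 = (#|B|.-1 + (j.+2 - #|B|))%N by lia.
  rewrite [X in mobius_rank_le X _]ej.
  apply: mobius_rank_leM; first exact: blockdeg.
  have lt : (j.+2 - #|B| < j.+1)%N by lia.
  exact: (mobius_rank_le_restrict (S := ~: cell_set B set0) (IHj _ lt)).
move=> T nz; have [cardT|ncardT] := eqVneq #|vpart T| j.+1.
  apply: (@rank_le_block _ G _ T (vpart T)); first by rewrite cardT /= leqnSn.
  exact: (mobius_on_cells_sub (@top_coef_iso j.+1)) nz.
apply: rhsdeg.
rewrite -(eq_mobius (phi := fun S => \sum_(v : G) (on_cells (top_coef j.+1) S
    + (-1) * on_cells (top_coef j.+1) (S :&: ~: [set inl v]))
    + (- j.+1%:R) * on_cells (top_coef j.+1) S)); last first.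
  move=> S _; rewrite -top_coef_rec_vertex mulNr; congr (_ - _).
  by apply: eq_bigr => v _; rewrite mulN1r.
rewrite mobiusD mobiusZ mobius_sum.
(* Deleting [v] retains just the coefficients at sets avoiding [v], so the difference contributes
   the coefficient at [T] once for each vertex of [T]. *)
have -> : \sum_(v : G) mobius (fun S => on_cells (top_coef j.+1) S
    + (-1) * on_cells (top_coef j.+1) (S :&: ~: [set inl v])) T
    = #|vpart T|%:R * mobius (on_cells (top_coef j.+1) (G := G)) T.
  rewrite mulr_natl -sumr_const [RHS]big_mkcond; apply: eq_bigr => v _.
  rewrite mobiusD mobiusZ mobius_restrict subsetC sub1set !inE.
  by case: (inl v \in T); rewrite ?mulr0 ?addr0 // mulN1r mulr1 subrr.
by rewrite -mulrDl mulf_neq0 // subr_eq0 eqr_nat.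
Qed.

(** In Newton's identity at [k.+1] the term of index 0 is the power sum itself, as [top_coef 0] is
    1; the other products have rank at most (i + 1) + (k - i). *)
Lemma power_sum_rank (G : sgraph) k : (0 < k)%N ->
  mobius_rank_le k (on_cells (fun H => root_power_sum k (f H)) (G := G)).
Proof.
elim/ltn_ind: k => -[|k] // IHk _.
pose p i := on_cells (fun H => root_power_sum i (f H)) (G := G).
pose t i := on_cells (top_coef i) (G := G).
have newton S : p k.+1 S = - k.+1%:R * t k.+1 S
    + (-1) * \sum_(i < k) t i.+1 S * p (k - i)%N S.
  have [m s] := f_monic (subgraph (vpart S) (epart S)).
  have := newton_root_power_sum k.+1 m s; rewrite big_ord_recl.
  have -> : rcoef #|subgraph (vpart S) (epart S)| (ord0 : 'I_k.+1)
    (f (subgraph (vpart S) (epart S))) = 1 by apply: top_coef0.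
  rewrite mul1r addrCA => /eqP; rewrite addr_eq0 => /eqP; rewrite subn0 => pk.
  by rewrite /p /on_cells pk mulNr mulN1r -opprD.
apply: (eq_mobius_rank_le (fun S => esym (newton S))).
apply: mobius_rank_leD; first exact/mobius_rank_leZ/top_coef_rank.
apply/mobius_rank_leZ/mobius_rank_le_sum => i _.
have ltik := ltn_ord i.
have ek : k.+1 = (i.+1 + (k - i))%N by lia.
rewrite [X in mobius_rank_le X _]ek.
apply: mobius_rank_leM; first exact: top_coef_rank.
by apply: IHk; lia.
Qed.

Lemma mobius_coef_large (G : sgraph) k : (0 < k)%N -> connected G ->
  (k.+1 < #|G|)%N -> mobius_coef (fun H => root_power_sum k (f H)) G = 0.
Proof.
move=> k0 cG large; apply: contraTeq large => /(power_sum_rank k0) r.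
by rewrite -leqNgt; apply: rank_le_connected r.
Qed.

End ExponentialType.


(** * Expansion into subgraph counts *)

Section CompleteGraph.
Variable T : finType.

Fact complete_card_edges (e : {set T}) :
  e \in [set e : {set T} | #|e| == 2%N] -> #|e| = 2%N.
Proof. by rewrite inE => /eqP. Qed.

Definition complete_graph : sgraph := SGraph complete_card_edges.

(** The subgraphs of one complete graph form a finite list meeting every isomorphism class of small
    graphs. *)
Lemma complete_graph_universal (H : sgraph) : (#|H| <= #|T|)%N ->
  exists S : {set complete_graph} * {set {set complete_graph}},
    isomorphic (subgraph S.1 S.2) H.
Proof.
move=> HT; pose h (x : H) : T := enum_val (widen_ord HT (enum_rank x)).
have h_inj : injective h.
  by move=> x y /enum_val_inj /(congr1 val) /= /val_inj /enum_rank_inj.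
exists (h @: [set: H], (fun e : {set H} => h @: e) @: edges H) => /=.
apply: isomorphic_sym; apply: isomorphic_trans (subgraph_isomorphicT H) _.
apply: (@subgraph_isomorphic H complete_graph h) => // e _.
rewrite !inE (mem_imset _ _ (imset_inj h_inj)) card_imset //.
by case eE: (e \in edges H); rewrite //= (card_edges eE) eqxx.
Qed.

End CompleteGraph.

(** The terms of [sum_mobius_coef] are grouped by isomorphism class; the bound [n] leaves finitely
    many classes. *)
Lemma subgraph_count_expansion (K : numFieldType) (g : sgraph -> K) (n : nat) :
  (forall G1 G2, isomorphic G1 G2 -> g G1 = g G2) ->
  (forall G : sgraph, mobius_coef g G != 0 -> (#|G| <= n)%N) ->
  exists (m : nat) (c : 'I_m -> K) (H : 'I_m -> sgraph),
    (forall i, mobius_coef g (H i) != 0) /\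
    forall G, g G = \sum_(i < m) c i * (subgraph_count (H i) G)%:R.
Proof.
move=> g_iso g_small; pose Kn := complete_graph 'I_n.
pose gr (y : {set Kn} * {set {set Kn}}) := subgraph y.1 y.2.
pose copies (H : sgraph) := [set y | `[< isomorphic (gr y) H >]].
pose P := [set y | mobius_coef g (gr y) != 0].
(* An isomorphism class occurs several times among the subgraphs of K_n; dividing
   by the number of its copies saves choosing representatives. *)
pose c y := mobius_coef g (gr y) / #|copies (gr y)|%:R.
exists #|P|, (fun i => c (enum_val i)), (fun i => gr (enum_val i)); split.
  by move=> i; have := enum_valP i; rewrite inE.
move=> G; rewrite -(big_enum_val (fun y => c y * (subgraph_count (gr y) G)%:R)).
transitivity (\sum_(y in P) \sum_(S : {set G} * {set {set G}} | is_subgraph S.1 S.2)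
    (if `[< isomorphic (gr y) (subgraph S.1 S.2) >] then c y else 0)); last first.
  apply: eq_bigr => y _; rewrite -big_mkcondr /= /subgraph_count mulr_natr -sumr_const.
  by apply: eq_bigl => S; rewrite inE.
rewrite exchange_big (sum_mobius_coef g_iso) /=; apply: eq_bigr => S _.
set H := subgraph _ _; rewrite -big_mkcondr /=.
have [z|nz] := eqVneq (mobius_coef g H) 0.
  rewrite z big1 // => y /andP[_ /asboolP yH].
  by rewrite /c (mobius_coef_iso g_iso yH) z mul0r.
have cE y : (y \in P) && `[< isomorphic (gr y) H >] = (y \in copies H).
  rewrite !inE; case: asboolP => yH; rewrite ?andbF // andbT.
  by rewrite (mobius_coef_iso g_iso yH) nz.
(* Each copy of [H] contributes an equal share of [mobius_coef g H]; a copy exists since [H] has at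
   most [n] vertices. *)
rewrite (eq_bigl _ _ cE) (eq_bigr (fun=> mobius_coef g H / #|copies H|%:R)).
  rewrite sumr_const -[RHS]mulr_natr divfK // pnatr_eq0 -lt0n; apply/card_gt0P.
  have [|y yH] := @complete_graph_universal 'I_n H.
    by rewrite card_ord; apply: g_small.
  by exists y; rewrite inE; apply/asboolP.
move=> y; rewrite inE => /asboolP yH; rewrite /c (mobius_coef_iso g_iso yH).
suff -> : copies (gr y) = copies H by [].
apply/setP => z; rewrite !inE; apply/asboolP/asboolP => zy.
  exact: isomorphic_trans zy yH.
exact: isomorphic_trans zy (isomorphic_sym yH).
Qed.

Theorem theorem6p6 (R : realType) (f : sgraph -> {poly R[i]})
    (f_iso : iso_invariant f) (f_monic : monic_graph_poly f)
    (f_exp : exponential_type f) (f_2mult : two_multiplicative f)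
    (k : nat) (k_ge1 : (1 <= k)%N) :
  exists (n : nat) (c : 'I_n -> R[i]) (H : 'I_n -> sgraph),
    (forall i, two_connected (H i) /\ (2 <= #|H i| <= k.+1)%N) /\
    forall G : sgraph,
      root_power_sum k (f G) = \sum_(i < n) c i * (subgraph_count (H i) G)%:R.
Proof.
pose p G := root_power_sum k (f G).
have two_conn G : mobius_coef p G != 0 -> two_connected G.
  move=> nz; apply: contrapT => n2.
  by move: nz; rewrite (mobius_coef_not_two_connected f_iso) ?eqxx.
have small (G : sgraph) : mobius_coef p G != 0 -> (#|G| <= k.+1)%N.
  move=> nz; have [_ cG _] := two_conn G nz.
  rewrite leqNgt; apply: contraNN nz => large.
  by rewrite (mobius_coef_large f_iso) ?eqxx.
have p_iso G1 G2 : isomorphic G1 G2 -> p G1 = p G2 by apply: power_sum_iso.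
have [n [c [H [Hnz HE]]]] := subgraph_count_expansion p_iso small.
exists n, c, H; split=> // i; have two := two_conn _ (Hnz i); split=> //.
by case: two => -> _ _; apply: small.
Qed.
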